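(* There is a regular Hausdorff topological space which is non-separable and hereditarily Lindelöf.
   Context: The ambient theory is ZFC, with no additional axioms. A space is hereditarily Lindelöf if each of its subspaces is Lindelöf. *)

(* Defs.v *)
From mathcomp Require Import all_boot all_order all_algebra.
From mathcomp Require Import all_classical all_reals all_analysis.

Set Implicit Arguments.
Unset Strict Implicit.
Unset Printing Implicit Defensive.

Local Open Scope classical_set_scope.

Definition separable_space (T : topologicalType) : Prop :=
  exists2 D : set T, countable D & dense D.

Definition lindelof_space (T : topologicalType) : Prop :=
  forall C : set (set T), C `<=` open -> cover C id = [set: T] ->
  exists C' : set (set T),
    [/\ C' `<=` C, countable C' & cover C' id = [set: T]].

(* [set_type A] carries the initial topology of its inclusion into [T], i.e.
   the usual subspace topology; [subspace A] would not do, since it keeps all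
   the points of [T] and makes those outside [A] isolated. *)
Definition hereditarily_lindelof_space (T : topologicalType) : Prop :=
  forall A : set T, lindelof_space (set_type A).

(* Main.v *)
Require Import Defs.
From HB Require Import structures.
From mathcomp Require Import all_boot all_order all_algebra.
From mathcomp Require Import all_classical all_reals all_analysis.
From mathcomp Require Import ring lra zify Rstruct.
From mathcomp Require wochoice.

(** The space is a variant of Moore's L space.  Its points are those of a
    well-ordered set [W] of type omega_1, and each pair [a < b] carries a colour,
    a bit [color a b].  The point [b] is identified with its [profile], the
    function sending [x] to the colour of [(x, b)] for [x < b], to true at
    [x = b] and to false beyond, and the topology is that of pointwise
    convergence of profiles.  Such a topology is zero-dimensional, hence
    regular, and it is Hausdorff because the value true at the largest possible
    place makes profiles distinct.  A countable set lies below some [u], and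
    then misses the nonempty open set of points whose profile is true at [u]:
    so no countable set is dense, whatever the colouring.

    Everything else goes into making the space hereditarily Lindelof.  If some
    cover of a subspace has no countable subcover, then each [th] has a point
    [b th] outside the basic neighbourhoods chosen for all points up to [th].
    To refute this it suffices to find [b th' <= th] such that the profile of
    [b th] agrees with that of [b th'] on the finite set [F] describing the
    neighbourhood chosen for [b th'] ([profile_realized]).  After making these
    finite sets uniform, one has to realize any prescribed pattern of colours
    between a finite tuple [a xi] and a point [b eta], for families indexed by
    [W] ([color_realized]).

    The colour of [(a, b)] is obtained from an oscillation number.  For each
    [b] a map [level b] from the points below [b] to the naturals is chosen, so
    that each is finite-to-one and any two differ at finitely many common
    places; and a walk from [b] down to [a] along a ladder system yields a
    finite list [trace a b] of points below [a].  The number [osc_number a b]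
    counts how often, along this list, [level a] passes from being at most
    [level b] to being above it.  The central fact, [oscillation_theorem], says
    that for any tuples [a xi] and points [b eta] one finds a single [xi] and
    points [eta m], for [m <= n], such that the number for [(a xi i, b (eta m))]
    is [s i + m].  All of these numbers can be shifted by one simultaneously,
    but the offsets [s i] are beyond control.

    Shifts are converted into colours by rotations.  Each point [a] has an
    angle, and the colour of [(a, b)] says in which half of the circle the
    angle multiplied by [osc_number a b] lies.  The angles are lacunary sums of
    powers of 2, built so that any finitely many distinct ones can be turned
    independently by quarter turns within a bounded time, wherever they start
    ([simultaneous_half_turns]).  As the bound does not depend on the starting
    positions, it can be fixed before the oscillation theorem is applied, and
    the unknown offsets do no harm. *)

Set Implicit Arguments.
Unset Strict Implicit.
Unset Printing Implicit Defensive.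

Import Order.TTheory.
Local Open Scope order_scope.
Local Open Scope classical_set_scope.

(** * Well-orders of type omega_1 and reflection *)

Definition omega1_like d (W : orderType d) : Prop :=
  [/\ well_founded (fun x y : W => x < y),
      forall x : W, countable [set y | y < x] & ~ countable [set: W]].

Lemma countable_range (C : countType) T (g : C -> T) : countable (range g).
Proof. exact: sub_countable (card_image_le _ _) (countableP _). Qed.

Lemma countable_surjection T (A : set T) (x0 : T) : countable A -> A x0 ->
  exists s : nat -> T, (forall n, A (s n)) /\ (forall y, A y -> exists n, s n = y).
Proof.
move=> /countable_injP[f finj] Ax0.
have Hs n : exists y, A y /\ ((exists2 z, A z & f z = n) -> f y = n).
  have [[z Az fz]|no] := pselect (exists2 z, A z & f z = n).
    by exists z.
  by exists x0; split.
have [s sP] := choice Hs; exists s; split=> [n|y Ay]; first by case: (sP n).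
exists (f y); have [As /(_ (ex_intro2 _ _ y Ay erefl))] := sP (f y).
by apply: finj; rewrite inE.
Qed.

Section Omega1.
Context {d : Order.disp_t} {W : orderType d}.
Hypothesis W1 : omega1_like W.

Let wfW : well_founded (fun x y : W => x < y). Proof. by case: W1. Qed.

Lemma least_element (P : W -> Prop) : (exists x, P x) ->
  exists x, P x /\ forall y, P y -> x <= y.
Proof.
case=> x Px; apply: contrapT => no; elim/(well_founded_ind wfW): x Px => x IH Px.
apply: no; exists x; split=> // y Py; rewrite leNgt; apply/negP => yx.
exact: IH yx Py.
Qed.

Lemma countable_le_segment (x : W) : countable [set y | y <= x].
Proof.
case: W1 => _ seg _.
suff -> : [set y | y <= x] = ([set y | y < x] `|` [set x])%classic.
  rewrite -bigcup2E; apply: bigcup_countable => // -[|[|i]] _ /=.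
  - exact: seg.
  - exact: countable1.
  - exact: countable0.
apply/seteqP; split=> y /=; first by rewrite le_eqVlt => /orP[/eqP|]; [right|left].
by case=> [/ltW|->].
Qed.

(** Otherwise [W] would be a countable union of countable initial segments. *)
Lemma countable_bounded (D : set W) : countable D -> exists u, forall x, D x -> x < u.
Proof.
case: W1 => _ _ unc cD; apply: contrapT => no; apply: unc.
apply: (@sub_countable _ _ _ (\bigcup_(x in D) [set y | y <= x])).
  apply: subset_card_le => u _; apply: contrapT => nu; apply: no; exists u => x Dx.
  by rewrite ltNge; apply/negP => ux; apply: nu; exists x.
by apply: bigcup_countable => // x _; exact: countable_le_segment.
Qed.

Lemma countable_family_bounded (C : countType) (g : C -> W) :
  exists u, forall p, g p < u.
Proof.
have [u uP] := countable_bounded (countable_range g).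
by exists u => p; apply: uP; exists p.
Qed.

(** Choosing enumerations once and for all lets parameters below [z], and finite
    lists of them, be replaced by natural numbers: this is how the families
    of sets to be reflected become countable. *)
Lemma segment_enumeration : exists en : W -> nat -> W,
  forall x y, y <= x -> exists n, en x n = y.
Proof.
have H (x : W) : exists s : nat -> W,
    (forall n, s n <= x) /\ (forall y, y <= x -> exists n, s n = y).
  by have := @countable_surjection _ [set y | y <= x] x (countable_le_segment x) (lexx x).
by have [en enP] := choice H; exists en => x; case: (enP x).
Qed.

Lemma enumerated_seq (en : W -> nat -> W) : (forall x y, y <= x -> exists n, en x n = y) ->
  forall z F, all (fun x => x <= z) F -> exists l, F = map (en z) l.
Proof.
move=> enP z; elim=> [|x F IH] /=; first by exists [::].
by move=> /andP[/enP[j <-] /IH[l ->]]; exists (j :: l).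
Qed.

Fixpoint running_max (s : nat -> W) n : W :=
  if n is n'.+1 then Order.max (running_max s n') (s n) else s 0.

(** The sequence [c b] climbs to [b] when [b] is a limit and eventually takes the
    value of the predecessor when [b] is a successor; it is unconstrained at
    the least element. *)
Definition is_ladder (c : W -> nat -> W) : Prop := forall a b, a < b ->
  [/\ forall n, c b n < b, {homo c b : m n / (m <= n)%N >-> m <= n}
    & exists n, a <= c b n].

Lemma ladder_exists : exists c, is_ladder c.
Proof.
have H (b : W) : exists s : nat -> W, forall a, a < b ->
  [/\ forall n, s n < b, {homo s : m n / (m <= n)%N >-> m <= n} & exists n, a <= s n].
  have [[a ab]|no] := pselect (exists a, a < b); last first.
    by exists (fun=> b) => a ab; case: no; exists a.
  case: W1 => _ seg _.
  have [s [sb sP]] := @countable_surjection _ [set y | y < b] a (seg b) ab.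
  exists (running_max s) => x xb; split.
  - by elim=> [|n IH] /=; [exact: sb | rewrite gt_max IH; exact: sb].
  - by apply: homo_leq => // [y x' z|n]; [exact: le_trans | rewrite /= le_max lexx].
  - have [n <-] := sP _ xb; exists n; case: n => [|n] //=; by rewrite le_max lexx orbT.
by have [c cP] := choice H; exists c => a b; exact: cP.
Qed.

(** A substitute for countable elementary submodels, with [dl] in the role of the
    trace of the submodel on omega_1: a set that is definable from a parameter
    below [dl] and reaches [dl] must be unbounded, for its bound, being
    definable too, would be below [dl]; and it meets every final segment of the
    points below [dl].  The point [dl] is the limit of a
    sequence along which both bounds of bounded sets and large elements of
    unbounded ones are thrown in. *)
Lemma reflection (C : countType) (P : W -> C -> set W) :
  exists2 dl, exists z, z < dl &
    forall x p, x < dl -> (exists2 y, dl <= y & P x p y) ->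
    (forall z, exists2 y, z < y & P x p y) /\
    (forall z, z < dl -> exists y, [/\ z < y, y < dl & P x p y]).
Proof.
have [en enP] := segment_enumeration.
(* [f] gives a bound of the set when it is bounded, an element above [q.2] when
   it is not. *)
have /choice[f fP] (q : W * C * W) : exists u,
    [/\ q.2 < u, P q.1.1 q.1.2 u & forall z, exists2 y, z < y & P q.1.1 q.1.2 y]
    \/ (forall y, P q.1.1 q.1.2 y -> y <= u).
  have [unb|/existsNP[z no]] := pselect (forall z, exists2 y, z < y & P q.1.1 q.1.2 y).
    by have [u u1 u2] := unb q.2; exists u; left.
  exists z; right=> y Py; rewrite leNgt; apply/negP => zy; apply: no.
  by exists y.
have /choice[h hP] (z : W) : exists u, z < u /\ forall x p, x <= z -> f (x, p, z) < u.
  have [u1 u1P] := countable_family_bounded (fun q : nat * C => f (en z q.1, q.2, z)).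
  have [u2 u2P] := countable_family_bounded (fun _ : unit => z).
  exists (Order.max u1 u2); rewrite lt_max (u2P tt) orbT; split=> // x p xz.
  by have [n <-] := enP _ _ xz; rewrite lt_max (u1P (n, p)).
have [w0 _] : exists w : W, True.
  by have [u _] := @countable_bounded set0 (@countable0 _); exists u.
pose s n := iter n h w0.
have [u uP] := countable_family_bounded s.
have [dl [dlP dlmin]] := @least_element (fun u => forall n, s n <= u)
  (ex_intro _ u (fun n => ltW (uP n))).
have sS n : s n < s n.+1 by case: (hP (s n)).
have sdl n : s n < dl by exact: lt_le_trans (sS n) (dlP _).
have smono : {homo s : m n / (m <= n)%N >-> m <= n}.
  by apply: homo_leq => [u'|u1 u2 u3|n]; [exact: lexx | exact: le_trans | exact: ltW].
have sup z : z < dl -> exists n, z < s n.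
  move=> zd; apply: contrapT => no; move: zd; apply/negP; rewrite -leNgt.
  apply: dlmin => n; rewrite leNgt; apply/negP => zs; apply: no.
  by exists n.
exists dl => [|x p /sup[n xn] [y dy Py]]; first by exists (s 0).
have key m : (n <= m)%N -> [/\ s m < f (x, p, s m), f (x, p, s m) < s m.+1,
    P x p (f (x, p, s m)) & forall z, exists2 y, z < y & P x p y].
  move=> nm; have xm : x <= s m by exact: le_trans (ltW xn) (smono _ _ nm).
  have [_ /(_ x p xm) fs] := hP (s m).
  have [[] //|/= /(_ _ Py) yf] := fP (x, p, s m).
  by have := lt_le_trans (le_lt_trans yf fs) (le_trans (ltW (sdl m.+1)) dy); rewrite ltxx.
split=> [|z]; first by case: (key n).
move=> /sup[m zm]; have [] := key (maxn n m) (leq_maxl _ _).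
move=> k1 k2 k3 _; exists (f (x, p, s (maxn n m))); split=> //; last exact: lt_trans k2 _.
by apply: lt_trans k1; apply: lt_le_trans zm (smono _ _ (leq_maxr _ _)).
Qed.
End Omega1.

(** * Walks and coherent levels *)

(** Recursion in which the recursive calls need no proof of descent: they return
    [r0] at arguments that are not smaller. *)
Definition wf_fix T (lt : T -> T -> Prop) (wf : well_founded lt) R (r0 : R)
    (F : T -> (T -> R) -> R) : T -> R :=
  Fix wf (fun=> R)
    (fun x rec => F x (fun y => if pselect (lt y x) is left h then rec y h else r0)).

Lemma wf_fixE T (lt : T -> T -> Prop) (wf : well_founded lt) R (r0 : R) F x :
  wf_fix wf r0 F x =
  F x (fun y => if `[< lt y x >] then wf_fix wf r0 F y else r0).
Proof.
rewrite {1}/wf_fix Fix_eq; last first.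
  by move=> y f g fg; congr F; apply/funext => z; case: pselect.
by congr F; apply/funext => y; rewrite /asbool; case: pselect.
Qed.

(** The default value 0 is returned when [P] is empty. *)
Definition least_index (P : pred nat) : nat :=
  if pselect (exists n, P n) is left h then ex_minn h else 0.

Lemma least_indexP (P : pred nat) n : P n -> P (least_index P) /\ (least_index P <= n)%N.
Proof.
rewrite /least_index => Pn; case: pselect => [h|]; last by case; exists n.
by case: ex_minnP => m Pm mP; split=> //; exact: mP.
Qed.

Section Walks.
Context {d : Order.disp_t} {W : orderType d}.
Hypothesis W1 : omega1_like W.
Variables (c : W -> nat -> W) (bot : W).
Hypotheses (cP : is_ladder c) (botP : forall x, bot <= x).

Let wfW : well_founded (fun x y : W => x < y). Proof. by case: W1. Qed.

Definition step a b : nat := least_index (fun n => a <= c b n).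

(** The largest member of the ladder of [b] below [a], with [bot] in the absence
    of members below [a]. *)
Definition step_pred a b : W := if step a b is n.+1 then c b n else bot.

Definition trace_rec (b : W) (rec : W -> W -> seq W) (a : W) : seq W :=
  if a < b then step_pred a b :: [seq x <- rec (c b (step a b)) a | step_pred a b <= x]
  else [::].

(** Moore's lower trace of the walk from [b] to [a]: the walk steps to the first
    member of the ladder that is at least [a], and the successive values of
    [step_pred] are recorded, omitting those below an earlier value. *)
Definition trace (a b : W) : seq W := wf_fix wfW (fun=> [::]) trace_rec b a.

Lemma stepP a b : a < b -> [/\ a <= c b (step a b), c b (step a b) < b &
  forall n, a <= c b n -> (step a b <= n)%N].
Proof.
move=> /cP[cb _ [n an]]; have [? _] := least_indexP (P := fun n => a <= c b n) an.
by split=> // m am; have [] := least_indexP (P := fun n => a <= c b n) am.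
Qed.

Lemma step_pred_lt a b : bot < a -> a < b -> step_pred a b < a.
Proof.
move=> ba /stepP[_ _]; rewrite /step_pred; case: (step a b) => [//|n] H.
by rewrite ltNge; apply/negP => /H; rewrite ltnn.
Qed.

Lemma traceE a b : a < b ->
  trace a b = step_pred a b :: [seq x <- trace a (c b (step a b)) | step_pred a b <= x].
Proof.
move=> ab; rewrite {1}/trace wf_fixE /trace_rec ab.
by have [_ cb _] := stepP ab; rewrite asboolT.
Qed.

Lemma trace_ge a b : b <= a -> trace a b = [::].
Proof. by move=> ba; rewrite /trace wf_fixE /trace_rec ltNge ba. Qed.

Lemma trace_neq_nil a b : a < b -> trace a b != [::].
Proof. by move=> /traceE ->. Qed.

Lemma trace_lt a b : bot < a -> all (fun x => x < a) (trace a b).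
Proof.
move=> ba; elim/(well_founded_ind wfW): b => b IH.
have [ab|/trace_ge-> //] := ltP a b.
rewrite traceE //= step_pred_lt //= all_filter.
have [_ /IH cb _] := stepP ab.
by apply: sub_all cb => x /= ->; rewrite implybT.
Qed.

(** Past the member [c dl n] of the ladder that exceeds [g], the first recorded
    value is at least [c dl n], and it bounds the others from below. *)
Lemma trace_escapes g dl : g < dl ->
  exists2 x0, x0 < dl & forall x, x0 < x -> x < dl -> all (fun y => g <= y) (trace x dl).
Proof.
move=> gd; have [cb cmono [n gn]] := cP gd.
exists (c dl n) => // x nx xd.
have gm : g <= step_pred x dl.
  apply: le_trans gn _; have [xs _ _] := stepP xd.
  have : ~~ (step x dl <= n)%N.
    by apply/negP => /cmono sn; have := lt_le_trans nx (le_trans xs sn); rewrite ltxx.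
  by rewrite -ltnNge /step_pred; case: (step x dl) => // k; rewrite ltnS => /cmono.
rewrite traceE //= gm all_filter /=.
by apply/allP => y _ /=; apply/implyP; exact: le_trans.
Qed.

(** When the walk from [b] to [dl] only records points below [g], the ladders met
    have no member between those points and [dl], so that walking to [a]
    takes the same steps until [dl] is reached. *)
Lemma trace_cat g a dl b : bot < a -> a < dl -> dl <= b -> g <= a ->
  all (fun x => x < g) (trace dl b) -> all (fun x => g <= x) (trace a dl) ->
  trace a b = trace dl b ++ trace a dl.
Proof.
move=> ba ad + ga + gd; elim/(well_founded_ind wfW): b => b IH.
rewrite le_eqVlt => /orP[/eqP<- _|db]; first by rewrite (trace_ge (lexx dl)).
rewrite (traceE db) /= => /andP[mg]; set m := step_pred dl b in mg *.
have ab := lt_trans ad db.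
have [sd sb smin] := stepP db; have [sa _ samin] := stepP ab.
have ss : step a b = step dl b.
  apply/eqP; rewrite eqn_leq samin ?(le_trans (ltW ad)) //=.
  rewrite leqNgt; apply/negP => lt_s.
  have : c b (step a b) <= m.
    rewrite /m /step_pred; case: (step dl b) lt_s => // k; rewrite ltnS.
    by have [_ cmono _] := cP ab; exact: cmono.
  by move=> /(le_trans sa) am; have := lt_le_trans mg (le_trans ga am); rewrite ltxx.
have mm : step_pred a b = m by rewrite /m /step_pred ss.
move=> fg; rewrite (traceE ab) mm ss; congr (_ :: _).
rewrite (IH _ sb sd) ?filter_cat.
  congr (_ ++ _); apply/all_filterP; apply: sub_all gd => x /=.
  exact: le_trans (ltW mg).
apply/allP => x xd; have [mx|xm] := leP m x; last exact: lt_trans mg.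
by move/allP: fg; apply; rewrite mem_filter mx.
Qed.

(** Taking the maximum with the index of the step is what makes [level b]
    finite-to-one: a level at most [N] leaves only the first [N + 1] steps. *)
Definition level_rec (b : W) (rec : W -> W -> nat) (x : W) : nat :=
  let n := least_index (fun n => x < c b n) in
  if x < c b n then maxn (rec (c b n) x) n else 0.

Definition level (b x : W) : nat := wf_fix wfW (fun=> 0%N) level_rec b x.

Lemma levelE b x n : x < b -> x < c b n ->
  exists k, [/\ (k <= n)%N, x < c b k & level b x = maxn (level (c b k) x) k].
Proof.
move=> xb xn; have [xk kn] := least_indexP (P := fun n => x < c b n) xn.
exists (least_index (fun n => x < c b n)); split=> //.
rewrite {1}/level wf_fixE /level_rec xk.
by have [cb _ _] := cP xb; rewrite asboolT.
Qed.

(** The points below [b] that are below no member of the ladder form the set [E]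
    of the proof: at most one point, the predecessor of [b]. *)
Lemma level_finite_to_one b N : finite_set [set x | x < b /\ (level b x <= N)%N].
Proof.
elim/(well_founded_ind wfW): b => b IH.
pose S n := [set x | x < c b n /\ (level (c b n) x <= N)%N].
pose E := [set x | x < b /\ forall n, c b n <= x].
have finE : finite_set E.
  have [[x [xb Ex]]|no] := pselect (exists x, E x).
    apply: sub_finite_set (finite_set1 x) => y [yb Ey] /=; apply/eqP.
    rewrite eq_le; apply/andP; split.
      by have [_ _ [n /le_trans]] := cP yb; apply; apply: Ex.
    by have [_ _ [n /le_trans]] := cP xb; apply; apply: Ey.
  by rewrite (_ : E = set0) // -subset0 => x Ex; apply: no; exists x.
have finS : finite_set (\bigcup_(n in `I_N.+1) (S n `&` [set _ | c b n < b])).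
  apply: bigcup_finite; first exact: finite_II.
  move=> n _; have [cb|cb] := boolP (c b n < b).
    by apply: sub_finite_set (IH _ cb); apply: subIset; left.
  by apply: sub_finite_set (@finite_set0 _) => x [_ /= cb']; case/negP: cb.
suff sub : [set x | x < b /\ (level b x <= N)%N] `<=`
    E `|` \bigcup_(n in `I_N.+1) (S n `&` [set _ | c b n < b]).
  by apply: sub_finite_set sub _; rewrite finite_setU.
move=> x [xb xN].
have [[n xn]|no] := pselect (exists n, x < c b n).
  right; have [k [kn xk lE]] := levelE xb xn.
  have [cb _ _] := cP xb.
  move: xN; rewrite lE geq_max => /andP[? ?].
  by exists k => //=.
left; split=> // n; rewrite leNgt; apply/negP => xn; apply: no.
by exists n.
Qed.

(** Below [a], only the finitely many steps up to the first member above [a]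
    occur.  For each of them [level b] is the maximum of a constant and of a
    finite-to-one function that agrees with [level a] up to a finite set. *)
Lemma level_coherent b a : a <= b ->
  finite_set [set x | x < a /\ level b x <> level a x].
Proof.
elim/(well_founded_ind wfW): b a => b IH a.
have {}IH u v : u < b -> v < b ->
    finite_set [set x | [/\ x < u, x < v & level u x <> level v x]].
  move=> ub vb; have [uv|vu] := leP u v.
    by apply: sub_finite_set (IH v vb u uv) => x [xu xv ne]; split=> // /esym.
  by apply: sub_finite_set (IH u ub v (ltW vu)) => x [xu xv ne]; split.
rewrite le_eqVlt => /orP[/eqP<-|ab].
  by apply: sub_finite_set (@finite_set0 _) => x [_]; case.
have [cb _ [n0 an0]] := cP ab.
pose S n := [set x | [/\ x < c b n, x < a & level (c b n) x <> level a x]].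
pose F n := [set x | x < c b n /\ (level (c b n) x <= n)%N].
have : finite_set (\bigcup_(n in `I_n0.+1) (S n `|` F n)).
  apply: bigcup_finite; first exact: finite_II.
  by move=> n _; rewrite finite_setU; split; [exact: IH | exact: level_finite_to_one].
apply: sub_finite_set => x [xa ne].
have [k [kn xk lE]] := levelE (lt_trans xa ab) (lt_le_trans xa an0).
exists k => //; have [lk|kl] := leqP (level (c b k) x) k; first by right; split.
by left; split=> //; rewrite lE (maxn_idPl (ltnW kl)) in ne.
Qed.

End Walks.

(** * Oscillations along a list *)

Section Osc.
Context {T : Type}.
Implicit Types (f g : T -> nat) (s : bool) (l : seq T).

(** The state [s] tells whether [f <= g] held at the previous point, so that a
    list can be cut into pieces. *)
Fixpoint osc f g s l : nat :=
  if l is x :: l' then ((s && (g x < f x)%N) + osc f g (f x <= g x)%N l')%N else 0.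

Definition osc_state f g s l : bool := foldl (fun _ x => (f x <= g x)%N) s l.

Lemma osc_cat f g s l1 l2 :
  osc f g s (l1 ++ l2) = (osc f g s l1 + osc f g (osc_state f g s l1) l2)%N.
Proof. by elim: l1 s => [|x l IH] s //=; rewrite IH addnA. Qed.

Lemma osc_state_cat f g s l1 l2 :
  osc_state f g s (l1 ++ l2) = osc_state f g (osc_state f g s l1) l2.
Proof. exact: foldl_cat. Qed.

Lemma osc_congr f g f' g' s l : map f l = map f' l -> map g l = map g' l ->
  osc f g s l = osc f' g' s l /\ osc_state f g s l = osc_state f' g' s l.
Proof.
by elim: l s => [|x l IH] s //= [-> fl] [-> gl]; have [-> ->] := IH (f' x <= g' x)%N fl gl.
Qed.

End Osc.

Section OscEq.
Context {T : eqType}.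
Implicit Types (f g : T -> nat) (s : bool) (l : seq T).

Lemma osc_below f g s l : {in l, forall x, (f x <= g x)%N} ->
  osc f g s l = 0 /\ osc_state f g s l = (l != [::]) || s.
Proof.
elim: l s => [|x l IH] s //= fg.
have [y yl|-> ->] := IH (f x <= g x)%N; first by apply: fg; rewrite inE yl orbT.
have fx : (f x <= g x)%N by apply: fg; rewrite mem_head.
by rewrite ltnNge fx andbF orbT.
Qed.

Lemma osc_above f g s l : {in l, forall x, (g x < f x)%N} -> l != [::] ->
  osc f g s l = s /\ osc_state f g s l = false.
Proof.
elim: l s => // x l IH s fg _ /=.
rewrite (fg _ (mem_head _ _)) andbT leqNgt (fg _ (mem_head _ _)) /=.
case: l IH fg => [|y l] IH fg; first by rewrite addn0.
have [z zl| |-> ->] // := IH false; last by rewrite addn0.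
by apply: fg; rewrite inE zl orbT.
Qed.

(** One oscillation comes from the passage from [l1] to [l2]; the passage from
    [l] to [l1] gives none, whatever the state at the end of [l]. *)
Lemma osc_one_more f g s l l1 l2 :
  {in l1, forall x, (f x <= g x)%N} -> l1 != [::] ->
  {in l2, forall x, (g x < f x)%N} -> l2 != [::] ->
  osc f g s (l ++ l1 ++ l2) = (osc f g s l).+1 /\
  osc_state f g s (l ++ l1 ++ l2) = false.
Proof.
move=> H1 n1 H2 n2; rewrite !osc_cat !osc_state_cat.
set t := osc_state f g s l.
have [-> ->] := osc_below t H1; rewrite n1 /=.
by have [-> ->] := osc_above true H2 n2; rewrite add0n addn1.
Qed.

End OscEq.

(** * The oscillation theorem *)

Section Oscillation.
Context {d : Order.disp_t} {W : orderType d}.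
Hypothesis W1 : omega1_like W.
Variables (c : W -> nat -> W) (bot : W).
Hypotheses (cP : is_ladder c) (botP : forall x, bot <= x).

Let tr := trace W1 c bot.
Let lv := level W1 c.

Definition osc_number (a b : W) : nat := osc (lv a) (lv b) false (tr a b).

Variables (k : nat) (a : W -> 'I_k -> W) (b : W -> W).
Hypotheses (aP : forall x i, x < a x i) (bP : forall x, x < b x).

Definition unbounded (A : set W) := forall z, exists2 y, z < y & A y.

(** A single [zt] serves all lists and all [n].  Otherwise, one [n] is bad for
    every [zt], and it yields infinitely many lists, each above the previous
    one, such that for every late [xi] in [A] some [lv (a xi i)] is at most [n]
    somewhere on each of them: a [xi] taken above all the lists then contradicts
    [level_finite_to_one]. *)
Lemma levels_escape (A : set W) : unbounded A -> exists zt, forall l n,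
  all (fun x => zt <= x) l -> forall th, exists xi,
    [/\ A xi, th <= xi & {in l, forall x i, (n < lv (a xi i) x)%N}].
Proof.
move=> unbA; apply: contrapT => no.
pose bad n zt := exists l, all (fun x => zt <= x) l /\ exists th, forall xi, A xi ->
  th <= xi -> exists x i, x \in l /\ (lv (a xi i) x <= n)%N.
have [n badn] : exists n, forall zt, bad n zt.
  apply: contrapT => /forallNP no'.
  have /choice[z zP] : forall n, exists zt, ~ bad n zt.
    by move=> n; have /existsNP := no' n.
  have [zt ztP] := countable_family_bounded W1 z.
  apply: no; exists zt => l n lz th; apply: contrapT => no''.
  apply: (zP n); exists l; split.
    by apply: sub_all lz => x; exact: le_trans (ltW (ztP n)).
  exists th => xi Axi thxi; apply: contrapT => no3; apply: no''.
  exists xi; split=> // x xl i; rewrite ltnNge; apply/negP => le_n; apply: no3.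
  by exists x, i.
have /choice[L LP] := badn.
have /choice[th thP] : forall zt, exists th, forall xi, A xi ->
  th <= xi -> exists x i, x \in L zt /\ (lv (a xi i) x <= n)%N.
  by move=> zt; have [_] := LP zt.
have /choice[nx nxP] : forall zt, exists u, all (fun x => x < u) (L zt).
  move=> zt; have [u uP] := countable_family_bounded W1 (fun j => nth zt (L zt) j).
  by exists u; apply/(all_nthP zt) => j _; exact: uP.
pose z j := iter j nx bot.
have zL j x : x \in L (z j) -> z j <= x /\ x < z j.+1.
  by move=> xL; have [/allP/(_ _ xL) ? _] := LP (z j); split=> //; exact: (allP (nxP _)).
have Lne j : exists x, x \in L (z j).
  have [xi _ Axi] := unbA (th (z j)); have [xi' tx Axi'] := unbA (th (z j)).
  by have [x [i []]] := thP (z j) xi' Axi' (ltW tx); exists x.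
have zmono : {homo z : i j / (i <= j)%N >-> i <= j}.
  apply: homo_leq => [u|u1 u2 u3|j]; [exact: lexx | exact: le_trans |].
  by have [x /zL[zx /ltW]] := Lne j; exact: le_trans.
have [u uP] := countable_family_bounded W1
  (fun p : bool * nat => if p.1 then z p.2 else th (z p.2)).
have [xi uxi Axi] := unbA u.
have /choice[x /choice[i xiP]] : forall j, exists x i, x \in L (z j) /\ (lv (a xi i) x <= n)%N.
  by move=> j; apply: thP Axi _; apply: ltW; exact: lt_trans (uP (false, j)) uxi.
have xinj : injective x.
  suff lt_x j1 j2 : (j1 < j2)%N -> x j1 < x j2.
    by move=> j1 j2 xx; case: (ltngtP j1 j2) => // /lt_x; rewrite xx ltxx.
  move=> jj; have [/zL[_ x1] _] := xiP j1; have [/zL[x2 _] _] := xiP j2.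
  exact: lt_le_trans x1 (le_trans (zmono _ _ jj) x2).
pose S i := [set y | y < a xi i /\ (lv (a xi i) y <= n)%N].
have finS : finite_set (\bigcup_(i in [set: 'I_k]) S i).
  by apply: bigcup_finite => // j _; exact: level_finite_to_one.
have : finite_set (x @^-1` (\bigcup_(i in [set: 'I_k]) S i)).
  by apply: finite_preimage finS => ? ? _ _; exact: xinj.
have -> : x @^-1` (\bigcup_(i in [set: 'I_k]) S i) = setT.
  apply/seteqP; split=> // j _; exists (i j) => //; have [xL ?] := xiP j; split=> //.
  have [_ xz] := zL _ _ xL.
  by apply: lt_trans (aP xi (i j)); apply: lt_trans uxi; exact: lt_trans (uP (true, j.+1)).
exact: infinite_nat.
Qed.

Definition agrees (F : seq W) (v : {ffun 'I_k -> seq nat}) : set W :=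
  [set xi | forall i, map (lv (a xi i)) F = v i].

(** The data of a pair [(xi, eta)] that a point [dl] between the lists and the pair
    can see, expressed with parameters below [dl].  A second point [ep > dl] in
    the same set provides, by [trace_cat], a pair for which the trace [F] is
    extended by [trace dl ep], where the levels agree. *)
Definition linked (F : seq W) (v : {ffun 'I_k -> seq nat}) (w : seq nat) (g1 g2 : W) : set W :=
  [set ep | exists xi eta, [/\ ep <= xi, ep <= eta, tr ep (b eta) = F,
     agrees F v xi & map (lv (b eta)) F = w] /\
     (forall x i, g1 <= x -> x < ep -> lv (a xi i) x = lv (b eta) x) /\
     (forall x, g2 < x -> x < ep -> all (fun y => g1 <= y) (tr x ep))].

Definition below (dl : W) (F : seq W) := all (fun x => x < dl) F.

(** What [reflection] gives at [dl] for the sets [agrees F v] and [linked F v w g1 g2]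
    and for the operations [a] and [levels_escape]. *)
Record critical (dl : W) : Prop := Critical {
  critical_bot : bot < dl;
  critical_limit : forall z, z < dl -> exists y, z < y /\ y < dl;
  critical_closed : forall x i, x < dl -> a x i < dl;
  critical_reflects : forall F v xi, below dl F -> dl <= xi -> agrees F v xi ->
    forall z, z < dl -> exists y, [/\ z < y, y < dl & agrees F v y];
  critical_escape : forall F v xi, below dl F -> dl <= xi -> agrees F v xi ->
    exists2 zt, zt < dl & forall l n,
      all (fun x => zt <= x) l -> exists xi',
      [/\ agrees F v xi', dl <= xi' & {in l, forall x i, (n < lv (a xi' i) x)%N}];
  critical_linked : forall F v w g1 g2, below dl F -> g1 < dl -> g2 < dl ->
    linked F v w g1 g2 dl -> exists2 ep, dl < ep & linked F v w g1 g2 ep }.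

Lemma below_bounded dl F : (exists z, z < dl) -> below dl F ->
  exists2 z, z < dl & all (fun x => x <= z) F.
Proof.
move=> [z0 z0d]; elim: F => [_|x F IH /= /andP[xd /IH[z zd Fz]]]; first by exists z0.
exists (Order.max x z); first by rewrite gt_max xd.
rewrite le_max lexx /=; apply: sub_all Fz => y yz; by rewrite le_max yz orbT.
Qed.

(** The constructors of the sum type index, from left to right, the sets
    [agrees F v], the points given by [levels_escape] for these sets, the sets
    [linked F v w g1 g2], the points [a z i], and the whole of [W], whose
    reflection makes [dl] a limit.  Points are treated as singletons: these are
    bounded, so they cannot reach [dl]. *)
Lemma critical_exists : exists dl, critical dl.
Proof.
have [en enP] := segment_enumeration W1.
have enF := enumerated_seq enP.
have /choice[zeta zetaP] : forall q : seq W * {ffun 'I_k -> seq nat}, exists zt,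
    unbounded (agrees q.1 q.2) -> forall l n,
  all (fun x => zt <= x) l -> forall th, exists xi,
    [/\ agrees q.1 q.2 xi, th <= xi & {in l, forall x i, (n < lv (a xi i) x)%N}].
  move=> q; have [unb|nu] := pselect (unbounded (agrees q.1 q.2)); last by exists bot.
  by have [zt ztP] := levels_escape unb; exists zt.
pose P (z : W) (p : (seq nat * {ffun 'I_k -> seq nat}) + (seq nat * {ffun 'I_k -> seq nat})
   + (seq nat * {ffun 'I_k -> seq nat} * seq nat * nat * nat) + 'I_k + unit) : set W :=
  match p with
  | inl (inl (inl (inl (l, v)))) => agrees (map (en z) l) v
  | inl (inl (inl (inr (l, v)))) => [set zeta (map (en z) l, v)]
  | inl (inl (inr (l, v, w, n1, n2))) => linked (map (en z) l) v w (en z n1) (en z n2)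
  | inl (inr i) => [set a z i]
  | inr tt => setT
  end.
have [dl dlne dlP] := reflection W1 P.
have single z p y : z < dl -> P z p = [set y] -> y < dl.
  move=> zd Py; rewrite ltNge; apply/negP => dy.
  have [|/(_ y)[y' yy']] := dlP z p zd; first by exists y; rewrite ?Py.
  by rewrite Py => /= y'y; rewrite y'y ltxx in yy'.
have agr F v xi : below dl F -> dl <= xi -> agrees F v xi ->
    unbounded (agrees F v) /\
    forall z, z < dl -> exists y, [/\ z < y, y < dl & agrees F v y].
  move=> /(below_bounded dlne)[z zd /enF[l ->]] dxi Axi.
  by apply: (dlP z (inl (inl (inl (inl (l, v))))) zd); exists xi.
exists dl; split.
- by case: dlne => z; exact: le_lt_trans.
- move=> z zd; have [|_ /(_ z zd)[y [? ? _]]] := dlP z (inr tt) zd; first by exists dl.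
  by exists y.
- by move=> x i xd; apply: (single x (inl (inr i))) => //.
- by move=> F v xi Fd dxi /(agr _ _ _ Fd dxi)[].
- move=> F v xi Fd dxi Axi; have [unb _] := agr _ _ _ Fd dxi Axi.
  exists (zeta (F, v)) => [|l n lz]; last first.
    by have [xi' [? ? ?]] := zetaP (F, v) unb l n lz dl; exists xi'.
  have [z zd /enF[l ->]] := below_bounded dlne Fd.
  exact: (single z (inl (inl (inl (inr (l, v)))))).
- move=> F v w g1 g2 Fd g1d g2d.
  have /(below_bounded dlne)[z zd /=] : below dl (g1 :: g2 :: F) by rewrite /= g1d g2d.
  move=> /and3P[/enP[n1 <-] /enP[n2 <-] /enF[l ->]] Ld.
  have [|/(_ dl)[ep dep Lep] _] := dlP z (inl (inl (inr (l, v, w, n1, n2)))) zd.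
    by exists dl.
  by exists ep.
Qed.

Lemma finite_below dl (A : set W) : critical dl -> finite_set A ->
  (forall x, A x -> x < dl) -> exists2 g, g < dl & forall x, A x -> x < g.
Proof.
move=> cr /finite_seqP[s ->] sd.
have {sd} : below dl s by apply/allP => x; exact: sd.
move=> /below_bounded[|z zd sz]; first by exists bot; exact: critical_bot.
have [g [zg gd]] := critical_limit cr zd.
by exists g => // x xs; apply: le_lt_trans zg; exact: (allP sz).
Qed.

(** By coherence, as [dl] is a limit and the exceptions below it are finite in
    number. *)
Lemma levels_agree_near dl (u : seq W) : critical dl -> all (fun x => dl <= x) u ->
  exists2 g, g < dl & forall x y, y \in u -> g <= x -> x < dl -> lv y x = lv dl x.
Proof.
move=> cr; elim: u => [_|y u IH /= /andP[dy /IH[g1 g1d g1P]]].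
  by exists bot => //; exact: critical_bot.
have [|g2 g2d g2P] := finite_below cr (level_coherent W1 cP dy).
  by move=> x [].
exists (Order.max g1 g2); first by rewrite gt_max g1d.
move=> x y'; rewrite inE ge_max => /orP[/eqP->|yu] /andP[gx1 gx2] xd; last exact: g1P.
by apply: contrapT => ne; have := g2P x (conj xd ne); rewrite ltNge gx2.
Qed.

Definition same_levels (F : seq W) xi xi' :=
  forall i, map (lv (a xi i)) F = map (lv (a xi' i)) F.

Definition levels F xi : {ffun 'I_k -> seq nat} := [ffun i => map (lv (a xi i)) F].

Lemma agreesE F xi xi' : agrees F (levels F xi) xi' <-> same_levels F xi' xi.
Proof. by split=> H i; have := H i; rewrite ffunE. Qed.

(** First half of an oscillation: the trace grows by a stretch, as high as wanted
    below [dl], where the levels of both sides coincide.  Near [dl] they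
    coincide already, with those of [dl], so [dl] is in the relevant set
    [linked]; this set has a larger element [ep], and the new stretch is
    [trace dl ep]. *)
Lemma extend_equal dl xi eta zt : critical dl -> dl <= xi -> dl <= eta -> zt < dl ->
  exists xi' eta' l, [/\ dl <= xi', dl <= eta', l != [::], all (fun x => zt <= x) l &
    [/\ tr dl (b eta') = tr dl (b eta) ++ l,
      map (lv (b eta')) (tr dl (b eta)) = map (lv (b eta)) (tr dl (b eta)),
      same_levels (tr dl (b eta)) xi' xi &
      {in l, forall x i, lv (a xi' i) x = lv (b eta') x}]].
Proof.
move=> cr dxi deta ztd; set F := tr dl (b eta).
have Fd : below dl F by apply: trace_lt => //; exact: critical_bot.
have db x : dl <= x -> dl < b x by move=> dx; exact: le_lt_trans (bP x).
have [g0 g0d g0P] : exists2 g, g < dl & forall x y,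
    y \in b eta :: [seq a xi i | i <- enum 'I_k] -> g <= x -> x < dl -> lv y x = lv dl x.
  apply: levels_agree_near => //=; rewrite (ltW (db _ deta)) /=.
  by apply/allP => _ /mapP[i _ ->]; apply: ltW; exact: le_lt_trans (aP xi i).
have [g [Fg gd gg0 gzt]] : exists g, [/\ all (fun x => x < g) F, g < dl, g0 <= g & zt <= g].
  have [||g' g'd /and3P[g1 g2 g3]] := @below_bounded dl (g0 :: zt :: F).
  - by exists bot; exact: critical_bot.
  - by rewrite /= g0d ztd.
  have [g [g'g gd]] := critical_limit cr g'd; exists g; split=> //.
  - by apply: sub_all g3 => x xg; exact: le_lt_trans g'g.
  - exact: le_trans g1 (ltW g'g).
  - exact: le_trans g2 (ltW g'g).
have [g2 g2d g2P] := trace_escapes W1 bot cP gd.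
have [|ep dep] := critical_linked cr Fd gd g2d (v := levels F xi) (w := map (lv (b eta)) F).
  exists xi, eta; split; first by split=> //; apply/agreesE.
  split=> // x i gx xd; have g0x := le_trans gg0 gx.
  rewrite (g0P x (b eta)) ?mem_head // (g0P x (a xi i)) // inE.
  by rewrite map_f ?orbT ?mem_enum.
move=> [xi' [eta' [[exi eeta trF /agreesE Axi wF] [eq_lv esc]]]].
have gl := esc dl g2d dep.
exists xi', eta', (tr dl ep); split.
- exact: ltW (lt_le_trans dep exi).
- exact: ltW (lt_le_trans dep eeta).
- exact: trace_neq_nil.
- by apply: sub_all gl => x; exact: le_trans.
split=> //.
- rewrite -trF; apply: (trace_cat cP (g := g)) => //.
  + exact: critical_bot.
  + by apply: ltW; exact: le_lt_trans (bP _).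
  + exact: ltW.
  + by rewrite -/tr trF.
- move=> x xl i; apply: eq_lv; first exact: (allP gl).
  apply: lt_trans dep; apply: (allP (trace_lt W1 cP _ (critical_bot cr))) xl.
Qed.

(** Two stretches are added, [l1] on which the levels are equal and [l2] on which
    those of [a] are larger.  For the second, [eta] is extended first, by
    [extend_equal]; then [xi] is replaced by one whose levels on [l2] exceed
    those of the new [eta], which [levels_escape] allows if [l2] lies above a
    point that depends only on the trace and the levels reached before.  This
    is why [extend_equal] has the parameter [zt]. *)
Lemma extend_oscillation dl xi eta : critical dl -> dl <= xi -> dl <= eta ->
  exists xi' eta', [/\ dl <= xi', dl <= eta',
    exists l, tr dl (b eta') = tr dl (b eta) ++ l,
    same_levels (tr dl (b eta)) xi' xi & forall i,
      osc (lv (a xi' i)) (lv (b eta')) false (tr dl (b eta')) =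
        (osc (lv (a xi i)) (lv (b eta)) false (tr dl (b eta))).+1
      /\ osc_state (lv (a xi' i)) (lv (b eta')) false (tr dl (b eta')) = false].
Proof.
move=> cr dxi deta; have b0 := critical_bot cr; set F := tr dl (b eta).
have [xi1 [eta1 [l1 [dxi1 deta1 n1 _ [tr1 b1 a1 eq1]]]]] := extend_equal cr dxi deta b0.
set F1 := tr dl (b eta1) in tr1.
have F1d : below dl F1 by exact: trace_lt.
have Axi1 : agrees F1 (levels F1 xi1) xi1 by apply/agreesE.
have [zt ztd ztP] := critical_escape cr F1d dxi1 Axi1.
have [xi2 [eta2 [l2 [dxi2 deta2 n2 l2zt [tr2 b2 _ _]]]]] := extend_equal cr dxi1 deta1 ztd.
rewrite -/F1 in tr2 b2.
have [xi3 [/agreesE a3 dxi3 gt3]] := ztP l2 (\max_(x <- l2) lv (b eta2) x) l2zt.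
have same3 : same_levels F xi3 xi.
  move=> i; have := a3 i; rewrite tr1 !map_cat => /eqP.
  by rewrite eqseq_cat ?size_map // a1 => /andP[/eqP].
have a31 i x : x \in l1 -> lv (a xi3 i) x = lv (a xi1 i) x.
  by move=> xl; apply/eq_in_map: x xl; have := a3 i; rewrite tr1 !map_cat => /eqP;
    rewrite eqseq_cat ?size_map // => /andP[_ /eqP].
have b2F : map (lv (b eta2)) F = map (lv (b eta)) F.
  move: b2; rewrite tr1 !map_cat => /eqP.
  by rewrite eqseq_cat ?size_map // b1 => /andP[/eqP].
have b21 x : x \in l1 -> lv (b eta2) x = lv (b eta1) x.
  by move=> xl; apply/eq_in_map: x xl; move: b2; rewrite tr1 !map_cat => /eqP;
    rewrite eqseq_cat ?size_map // => /andP[_ /eqP].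
exists xi3, eta2; split=> //.
  by exists (l1 ++ l2); rewrite tr2 tr1 catA.
move=> i; rewrite tr2 tr1 -catA.
have [<- _] := osc_congr false (same3 i) b2F.
apply: osc_one_more => // x xl.
  by rewrite a31 // b21 // eq1.
apply: leq_ltn_trans (gt3 x xl i).
by rewrite (big_rem x) //= leq_maxl.
Qed.

(** One [xi] serves all [m]: the traces extend one another, and each new [xi]
    keeps the levels of the previous ones on the earlier traces.  An initial
    oscillation ensures that the final state is false for [m = 0] too. *)
Lemma many_oscillations dl n : critical dl ->
  exists xi (eta : nat -> W) (s : 'I_k -> nat), dl <= xi /\ forall m, (m <= n)%N ->
   [/\ dl <= eta m, exists l, tr dl (b (eta n)) = tr dl (b (eta m)) ++ l & forall i,
      osc (lv (a xi i)) (lv (b (eta m))) false (tr dl (b (eta m))) = (s i + m)%N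
      /\ osc_state (lv (a xi i)) (lv (b (eta m))) false (tr dl (b (eta m))) = false].
Proof.
move=> cr; elim: n => [|n [xi [eta [s [dxi IH]]]]].
  have [xi [eta [dxi deta _ _ H]]] := extend_oscillation cr (lexx dl) (lexx dl).
  exists xi, (fun=> eta), (fun i => osc (lv (a xi i)) (lv (b eta)) false (tr dl (b eta))).
  split=> // m; rewrite leqn0 => /eqP->; split=> //; first by exists [::]; rewrite cats0.
  by move=> i; rewrite addn0; have [] := H i.
have [dn _ oscn] := IH n (leqnn n).
have [xi' [eta' [dxi' deta' [l trl] same H]]] := extend_oscillation cr dxi dn.
exists xi', (fun m => if m == n.+1 then eta' else eta m), s; split=> // m.
rewrite eqxx leq_eqVlt ltnS; case: eqP => [-> _|_ /= mn].
  split=> //; first by exists [::]; rewrite cats0.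
  by move=> i; have [-> ->] := H i; have [-> _] := oscn i; rewrite addnS.
have [dm [l' trl'] oscm] := IH m mn; split=> //.
  by exists (l' ++ l); rewrite trl trl' catA.
move=> i; have := same i; rewrite trl' !map_cat => /eqP.
rewrite eqseq_cat ?size_map // => /andP[/eqP eqm _].
by have [-> ->] := osc_congr false eqm (erefl (map (lv (b (eta m))) (tr dl (b (eta m))))).
Qed.

(** It remains to bring [xi] below [dl].  A reflected [xi'] close enough to [dl]
    has the same levels on the traces obtained so far, and its own trace
    [tr (a xi' i) dl] is appended to each of them, at a place where all the
    [b (eta m)] have the levels of [dl].  As the traces end in state false,
    the oscillations added do not depend on [m]. *)
Theorem oscillation_theorem n :
  exists dl xi (eta : nat -> W) (s : 'I_k -> nat),
    (forall i, a xi i < dl) /\ forall m, (m <= n)%N ->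
      dl <= eta m /\ forall i, osc_number (a xi i) (b (eta m)) = (s i + m)%N.
Proof.
have [dl cr] := critical_exists; have b0 := critical_bot cr.
have [xi [eta [s [dxi H]]]] := many_oscillations n cr.
set F := tr dl (b (eta n)).
have Fd : below dl F by exact: trace_lt.
pose u := [seq b (eta m) | m <- iota 0 n.+1].
have inu m : (m <= n)%N -> b (eta m) \in u.
  by move=> mn; apply: map_f; rewrite mem_iota.
have db m : (m <= n)%N -> dl < b (eta m).
  by move=> /H[dm _ _]; exact: le_lt_trans (bP _).
have [|g0 g0d g0P] := @levels_agree_near dl u cr.
  by apply/allP => _ /mapP[m + ->]; rewrite mem_iota /= ltnS => /db /ltW.
have [g [Fg gd gg0]] : exists g, [/\ all (fun x => x < g) F, g < dl & g0 <= g].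
  have [||g' g'd /andP[g1 g3]] := @below_bounded dl (g0 :: F).
  - by exists bot.
  - by rewrite /= g0d.
  have [g [g'g gd]] := critical_limit cr g'd; exists g; split=> //.
  - by apply: sub_all g3 => x xg; exact: le_lt_trans g'g.
  - exact: le_trans g1 (ltW g'g).
have [g2 g2d g2P] := trace_escapes W1 bot cP gd.
have mx : Order.max g g2 < dl by rewrite gt_max gd.
have Axi : agrees F (levels F xi) xi by apply/agreesE.
have [xi' [+ xid /agreesE same]] := critical_reflects cr Fd dxi Axi mx.
rewrite gt_max => /andP[gxi g2xi].
have ad i : a xi' i < dl by exact: (critical_closed cr).
have gl i : all (fun x => g <= x) (tr (a xi' i) dl).
  by apply: g2P => //; exact: lt_trans (aP _ _).
exists dl, xi', eta, (fun i => s i + osc (lv (a xi' i)) (lv dl) false (tr (a xi' i) dl))%N.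
split=> // m mn; have [dm [l trl] oscm] := H m mn; split=> // i.
have trm : tr (a xi' i) (b (eta m)) = tr dl (b (eta m)) ++ tr (a xi' i) dl.
  apply: (trace_cat cP (g := g)) => //.
  - exact: le_lt_trans (botP _) (aP _ _).
  - exact: ltW (db m mn).
  - exact: ltW (lt_trans gxi (aP _ _)).
  - by have := Fg; rewrite /F trl all_cat => /andP[].
have eqm : map (lv (a xi' i)) (tr dl (b (eta m))) = map (lv (a xi i)) (tr dl (b (eta m))).
  have := same i; rewrite /F trl !map_cat => /eqP.
  by rewrite eqseq_cat ?size_map // => /andP[/eqP].
rewrite /osc_number trm osc_cat.
have [-> ->] := osc_congr false eqm (erefl (map (lv (b (eta m))) (tr dl (b (eta m))))).
have [-> ->] := oscm i.
have -> : osc (lv (a xi' i)) (lv (b (eta m))) false (tr (a xi' i) dl) =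
          osc (lv (a xi' i)) (lv dl) false (tr (a xi' i) dl); last by rewrite addnAC.
apply: (proj1 (osc_congr _ _ _)) => //; apply/eq_in_map => x xl.
apply: g0P; first exact: inu.
  by apply: le_trans gg0 _; exact: (allP (gl i)).
apply: lt_trans (ad i); apply: (allP (trace_lt W1 cP _ _)) xl.
exact: le_lt_trans (botP _) (aP _ _).
Qed.

End Oscillation.

(** * Angles that turn independently *)

Import GRing.Theory Num.Theory.

Section Codes.
Local Open Scope nat_scope.
Implicit Types A B : nat -> bool.

(** The binary numeral with a leading 1 and then the bits [A 0], ..., [A (l - 1)],
    the last one in the units place. *)
Fixpoint prefix_code A l : nat :=
  if l is l'.+1 then A l' + (prefix_code A l').*2 else 1.

Lemma prefix_code_inj A B l l' : prefix_code A l = prefix_code B l' ->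
  l = l' /\ forall p, p < l -> A p = B p.
Proof.
have pos C j : 0 < prefix_code C j.
  by elim: j => //= j IH; rewrite addn_gt0 double_gt0 IH orbT.
elim: l l' => [|l IH] [|l'] //=.
- by move=> H; have := pos B l'; move: H; case: (B l') => /=; lia.
- by move=> H; have := pos A l; move: H; case: (A l) => /=; lia.
move=> H; have eqb : A l = B l'.
  by have := congr1 odd H; rewrite !oddD !odd_double !addbF !oddb.
have [|<- AB] := IH l'; first by move: H; rewrite eqb; lia.
split=> // p; rewrite ltnS leq_eqVlt => /orP[/eqP->|/AB //].
by rewrite eqb; congr (B _); have [] := IH l'; first by move: H; rewrite eqb; lia.
Qed.

Lemma prefix_code_gt A l : l < prefix_code A l.
Proof. by elim: l => //= l IH; lia. Qed.

(** The subset of the naturals attached to [A]: distinct sequences have almost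
    disjoint such sets. *)
Definition codes_prefix A n : bool := [exists l : 'I_n, prefix_code A l == n].

Lemma codes_prefix_code A B l : codes_prefix B (prefix_code A l) ->
  forall p, p < l -> A p = B p.
Proof. by move=> /existsP[l' /eqP/esym/prefix_code_inj[]]. Qed.

Lemma codes_prefix_self A l : codes_prefix A (prefix_code A l).
Proof. by apply/existsP; exists (Ordinal (prefix_code_gt A l)). Qed.

(** Past [l0] the prefixes of the [A i] differ, so that each [A i] owns a code
    that belongs to none of the others. *)
Lemma distinct_prefixes k (A : 'I_k -> nat -> bool) : injective A -> exists l0,
  forall l, l0 <= l -> forall i j, codes_prefix (A j) (prefix_code (A i) l) = (i == j).
Proof.
move=> Ainj.
have /choice[p pP] : forall q : 'I_k * 'I_k, exists p,
    q.1 != q.2 -> A q.1 p <> A q.2 p.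
  move=> [i j] /=; apply: contrapT => /forallNP no.
  apply: (no 0) => ij; exfalso; move/eqP: ij; apply; apply: Ainj; apply/funext => p.
  by apply: contrapT => ne; apply: (no p).
exists (\max_q (p q).+1) => l l0l i j.
apply/idP/eqP => [/codes_prefix_code H|->]; last exact: codes_prefix_self.
apply: contrapT => /eqP ij; apply: (pP (i, j) ij); apply: H.
by apply: leq_trans l0l; exact: (leq_bigmax (F := fun q => (p q).+1) (i, j)).
Qed.

End Codes.

Section Rotations.
Local Open Scope ring_scope.
Context {R : realType}.

Fixpoint lacunary_exp c : nat := if c is c'.+1 then (lacunary_exp c' + (c' + 4))%N else 0%N.

Fixpoint lacunary_num (eps : nat -> bool) c : nat :=
  if c is c'.+1 then (2 ^ (c' + 4) * lacunary_num eps c' + eps c')%N else 0%N.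

Definition quarter_time c : nat := (2 ^ (lacunary_exp c + (c + 2)))%N.

(** The angle is the sum of [eps c / 2 ^ lacunary_exp c.+1].  Multiplied by
    [quarter_time c], the terms before the [c]-th become integers, the [c]-th
    becomes [eps c / 4], and the gaps between the exponents make the rest tiny.
    The angle is obtained as the supremum of the partial sums [u], with upper
    bounds [v]. *)
Lemma lacunary_angle (eps : nat -> bool) : exists2 th : R, 0 <= th & forall c,
  exists z : nat, let r := (quarter_time c)%:R * th - z%:R - (eps c)%:R / 4 in
  0 <= r /\ r * 2 ^+ c <= 1.
Proof.
pose T c : R := (lacunary_num eps c)%:R; pose Q c : R := 2 ^+ lacunary_exp c.
have Q0 c : 0 < Q c by rewrite exprn_gt0.
have QS c : Q c.+1 = Q c * 2 ^+ c * 16 by rewrite /Q /= !exprD; ring.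
have TS c : T c.+1 = 2 ^+ c * 16 * T c + (eps c)%:R.
  by rewrite /T /= natrD natrM natrX exprD; ring.
have e01 c : 0 <= ((eps c)%:R : R) <= 1 by case: (eps c); rewrite /= ?ler01 ?lexx.
have p2 c : 1 <= 2 ^+ c :> R by rewrite exprn_ege1 // ler1n.
pose u c := T c / Q c; pose v c := (T c + (2 ^+ c * 8)^-1) / Q c.
have uS c : u c <= u c.+1.
  rewrite /u TS QS ler_pdivlMr; last by rewrite -QS.
  have -> : T c / Q c * (Q c * 2 ^+ c * 16) = 2 ^+ c * 16 * T c by field; rewrite gt_eqF.
  by have /andP[e0 _] := e01 c; rewrite lerDl.
have vS c : v c.+1 <= v c.
  rewrite /v TS QS ler_pdivrMr; last by rewrite -QS.
  have p0 : 2 ^+ c != 0 :> R by rewrite gt_eqF // (lt_le_trans ltr01).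
  have -> : (T c + (2 ^+ c * 8)^-1) / Q c * (Q c * 2 ^+ c * 16) = 2 ^+ c * 16 * T c + 2.
    by field; rewrite p0 gt_eqF.
  rewrite -addrA lerD2l; have /andP[_ e1] := e01 c.
  have : (2 ^+ c.+1 * 8)^-1 <= 1 :> R.
    rewrite invf_le1; first by have := p2 c.+1; lra.
    by have := p2 c.+1; lra.
  lra.
have umono : {homo u : m n / (m <= n)%N >-> m <= n}.
  by apply: homo_leq => [x|x y z|n]; [exact: lexx | exact: le_trans | exact: uS].
have vmono : {homo v : m n / (m <= n)%N >-> n <= m}.
  apply: (@homo_leq _ v (fun x y => y <= x)) => [x|x y z xy yz|n]; [exact: lexx | | exact: vS].
  exact: le_trans xy.
have uv m n : u m <= v n.
  apply: (le_trans (umono _ _ (leq_maxl m n))); apply: le_trans (vmono _ _ (leq_maxr m n)).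
  rewrite ler_pM2r ?invr_gt0 // lerDl invr_ge0.
  by rewrite mulr_ge0 // exprn_ge0.
have supu : has_sup (range u).
  by split; [exists (u 0%N), 0%N | exists (v 0%N) => _ [n _ <-]; exact: uv].
have usup c : u c <= sup (range u) by apply: sup_upper_bound => //; exists c.
have supv c : sup (range u) <= v c.
  by apply: ge_sup => [|_ [n _ <-]]; [exists (u 0%N), 0%N | exact: uv].
exists (sup (range u)).
  by apply: le_trans (usup 0%N); rewrite /u /T /= mul0r.
move=> c; exists (2 ^ (c + 2) * lacunary_num eps c)%N => /=.
set th := sup _.
have -> : (quarter_time c)%:R * th - (2 ^ (c + 2) * lacunary_num eps c)%:R - (eps c)%:R / 4
    = (Q c.+1 * th - T c.+1) / 4.
  by rewrite TS QS /quarter_time natrM !natrX !exprD -/(T c) -/(Q c); field.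
have h1 : T c.+1 <= Q c.+1 * th by rewrite mulrC -ler_pdivrMr //; exact: usup.
have h2 : Q c.+1 * th <= T c.+1 + (2 ^+ c.+1 * 8)^-1.
  by rewrite mulrC -ler_pdivlMr //; exact: supv.
split; first by rewrite divr_ge0 // subr_ge0.
apply: (@le_trans _ _ ((2 ^+ c.+1 * 8)^-1 / 4 * 2 ^+ c)).
  by rewrite ler_wpM2r ?exprn_ge0 // ler_wpM2r // lerBlDl.
rewrite exprS; have -> : (2 * 2 ^+ c * 8)^-1 / 4 * 2 ^+ c = 64^-1 :> R.
  by field; rewrite gt_eqF // (lt_le_trans ltr01).
lra.
Qed.

Definition half_turn (th : R) (n : nat) : bool := odd (Num.truncn (2 * (n%:R * th))).

(** A half circle consists of two consecutive quarters.  The number of quarter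
    turns is chosen to land in the first one, which leaves room for a further
    rotation [r] by less than a quarter. *)
Lemma quarter_turns (y : R) (t : bool) : 0 <= y -> exists2 l : nat, (l <= 3)%N &
  forall (z : nat) (r : R), 0 <= r -> r < 4^-1 ->
    odd (Num.truncn (2 * (y + z%:R + l%:R / 4 + r))) = t.
Proof.
move=> y0; have y40 : 0 <= 4 * y by rewrite mulr_ge0.
have /andP[f1 f2] := truncn_itv y40; set f := Num.truncn _ in f1 f2.
have [l l3 [q lq]] : exists2 l, (l <= 3)%N & exists q, (f + l = 4 * q + 2 * t)%N.
  exists ((4 + 2 * t - f %% 4) %% 4)%N; first by rewrite -ltnS ltn_mod.
  exists ((f + (4 + 2 * t - f %% 4) %% 4) %/ 4)%N; case: t; lia.
exists l => // z r r0 r4.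
have lqR : f%:R + l%:R = 4 * q%:R + 2 * t%:R :> R by rewrite -natrD lq natrD !natrM.
have -> : Num.truncn (2 * (y + z%:R + l%:R / 4 + r)) = (2 * q + t + 2 * z)%N.
  have E : (2 * q + t + 2 * z)%N%:R = 2 * q%:R + t%:R + 2 * z%:R :> R.
    by ring.
  move: f2; rewrite -[X in _ < X]natr1 => f2.
  by apply: truncn_def; rewrite -[X in _ < X]natr1 E; apply/andP; split; lra.
by rewrite !(oddM, oddD) /= addbF oddb.
Qed.

(** The number [m] combines, for each [i], at most three times [quarter_time] of a
    code owned by [A i]: these turn the [i]-th angle by quarters and, up to
    small errors, leave the others in place.  Codes longer than [12 * k] keep
    the sum of the errors below a quarter. *)
Theorem simultaneous_half_turns : exists th : (nat -> bool) -> R,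
  forall k (A : 'I_k -> nat -> bool), injective A -> exists N,
  forall (s : 'I_k -> nat) (t : 'I_k -> bool), exists2 m, (m <= N)%N &
  forall i, half_turn (th (A i)) (s i + m) = t i.
Proof.
have /choice[th thP] : forall A : nat -> bool, exists th : R, 0 <= th /\ forall c,
    exists z : nat, let r := (quarter_time c)%:R * th - z%:R - (codes_prefix A c)%:R / 4 in
    0 <= r /\ r * 2 ^+ c <= 1.
  by move=> A; have [th th0 thP] := lacunary_angle (codes_prefix A); exists th.
exists th => k A /distinct_prefixes[l0 l0P].
pose L := maxn l0 (12 * k); pose c i := prefix_code (A i) L.
exists (\sum_i 3 * quarter_time (c i))%N => s t.
have /choice[l lP] : forall i, exists l : nat, (l <= 3)%N /\
  forall (z : nat) (r : R), 0 <= r -> r < 4^-1 ->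
    odd (Num.truncn (2 * ((s i)%:R * th (A i) + z%:R + l%:R / 4 + r))) = t i.
  move=> i; have [|l l3 lP] := @quarter_turns ((s i)%:R * th (A i)) (t i).
    by rewrite mulr_ge0 //; case: (thP (A i)).
  by exists l.
exists (\sum_i l i * quarter_time (c i))%N.
  by apply: leq_sum => i _; rewrite leq_mul2r; case: (lP i) => ->; rewrite orbT.
move=> j.
have /choice[z zP] : forall i, exists z : nat,
    let r := (quarter_time (c i))%:R * th (A j) - z%:R - (i == j)%:R / 4 in
    0 <= r /\ r * 2 ^+ c i <= 1.
  move=> i; have [_ /(_ (c i))[z]] := thP (A j).
  by rewrite /c l0P ?leq_maxl //; exists z.
pose r i := (quarter_time (c i))%:R * th (A j) - (z i)%:R - (i == j)%:R / 4.
have r0 i : 0 <= r i by case: (zP i).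
have rk i : r i * (12 * k).+1%:R <= 1.
  case: (zP i) => _; apply: le_trans; apply: ler_wpM2l; first exact: r0.
  rewrite -natrX ler_nat; apply: (leq_trans _ (ltn_expl _ _)) => //.
  by rewrite ltnS; apply: leq_trans (leq_maxr l0 _) (ltnW (prefix_code_gt _ _)).
rewrite /half_turn [(s j + _)%N%:R]natrD [(_ + _) * th _]mulrDl.
have -> : (\sum_i l i * quarter_time (c i))%N%:R * th (A j) =
    (\sum_i l i * z i)%N%:R + (l j)%:R / 4 + \sum_i (l i)%:R * r i.
  rewrite !natr_sum mulr_suml.
  have -> : (l j)%:R / 4 = \sum_i (l i)%:R * ((i == j)%:R / 4) :> R.
    rewrite (bigD1 j) //= eqxx mul1r big1 ?addr0 // => i /negbTE ->.
    by rewrite mul0r mulr0.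
  rewrite -!big_split /=; apply: eq_bigr => i _; rewrite !natrM /r; ring.
rewrite !addrA; case: (lP j) => _; apply.
  by apply: sumr_ge0 => i _; rewrite mulr_ge0.
apply: (@le_lt_trans _ _ (\sum_(i < k) 3 / (12 * k).+1%:R)).
  apply: ler_sum => i _; have [l3 _] := lP i.
  apply: ler_pM => //; first by rewrite ler_nat.
  by rewrite -[X in _ <= X]mul1r ler_pdivlMr.
rewrite sumr_const card_ord -[_ *+ k]mulr_natl mulrA ltr_pdivrMr //.
rewrite -[(12 * k).+1%:R]natr1 natrM.
by have : 0 <= k%:R :> R by []; lra.
Qed.

End Rotations.

(** * The colouring and its profiles *)

Section Coloring.
Context {d : Order.disp_t} {W : orderType d}.
Hypothesis W1 : omega1_like W.
Variables (c : W -> nat -> W) (bot : W) (g : W -> nat -> bool).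
Hypotheses (cP : is_ladder c) (botP : forall x, bot <= x).

Definition color (a b : W) : bool := g a (osc_number W1 c bot a b).

(** The bound [N] precedes the shifts [s], because the oscillation theorem takes
    the number of oscillations before it gives the offsets. *)
Definition hits_within N k (A : 'I_k -> W) : Prop :=
  forall (s : 'I_k -> nat) (t : 'I_k -> bool),
  exists2 m, (m <= N)%N & forall i, g (A i) (s i + m)%N = t i.

Lemma color_realized k (a : W -> 'I_k -> W) (b : W -> W) N (t : 'I_k -> bool) :
  (forall x i, x < a x i) -> (forall x, x < b x) -> (forall x, hits_within N (a x)) ->
  exists dl xi eta,
    [/\ forall i, a xi i < dl, dl <= eta & forall i, color (a xi i) (b eta) = t i].
Proof.
move=> aP bP aN.
have [dl [xi [eta [s [ad H]]]]] := oscillation_theorem W1 cP botP aP bP N.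
have [m mN mP] := aN xi s t; have [dm oscm] := H m mN.
by exists dl, xi, (eta m); split=> // i; rewrite /color oscm.
Qed.

Hypothesis gP : forall k (A : 'I_k -> W), injective A -> exists N, hits_within N A.

Definition profile (b x : W) : bool := (x == b) || (x < b) && color x b.

(** The set of the neighbourhood of [b th'] is split at [th'].  By reflection, for
    [th'] in an unbounded set, the part below [th'] is constant along with the
    values of the profile on it, and the upper part has a constant pattern;
    the colours are then realized on upper parts.  The point [b th'] is itself
    put into the upper part, whence [b th' <= th]. *)
Lemma profile_realized (b : W -> W) (F : W -> seq W) : (forall x, x < b x) ->
  exists th' th, b th' <= th /\ {in F (b th'), profile (b th) =1 profile (b th')}.
Proof.
move=> bP; have [en enP] := segment_enumeration W1.
pose G th := undup (b th :: F (b th)).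
pose low th := [seq x <- G th | x < th]; pose up th := [seq x <- G th | th <= x].
pose P (z : W) (q : seq nat * seq bool * nat * seq bool * nat) : set W :=
  let: (l, p, k, t, N) := q in
  [set th | [/\ low th = map (en z) l, map (profile (b th)) (low th) = p,
    size (up th) = k, map (profile (b th)) (up th) = t &
    hits_within N (fun i : 'I_k => nth bot (up th) i)]].
have [dl dlne dlP] := reflection W1 P.
have [z zd /(enumerated_seq enP)[l lE]] : exists2 z, z < dl & all (fun x => x <= z) (low dl).
  by apply: below_bounded => //; apply/allP => x; rewrite mem_filter => /andP[].
have [N NP] : exists N, hits_within N (fun i : 'I_(size (up dl)) => nth bot (up dl) i).
  apply: gP => i j /eqP; rewrite nth_uniq // => [/eqP/val_inj //|].
  by rewrite filter_uniq // undup_uniq.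
have [|unb _] := dlP z (l, map (profile (b dl)) (low dl), size (up dl),
    map (profile (b dl)) (up dl), N) zd; first by exists dl.
move: unb; set k := size _; set p := map _ (low dl); set t := map _ (up dl) => unb.
have /choice[ph phP] : forall x, exists y, x < y /\ P z (l, p, k, t, N) y.
  by move=> x; have [y ? ?] := unb x; exists y.
pose a x (i : 'I_k) := nth bot (up (ph x)) i.
have a_in x i : a x i \in up (ph x).
  by apply: mem_nth; have [_ [_ _ -> _ _]] := phP x.
have [||x|dl' [xi [eta [adl deta col]]]] :=
    @color_realized k a (b \o ph) N (fun i => nth false t i).
- move=> x i; have [xph _] := phP x; apply: lt_le_trans xph _.
  by have := a_in x i; rewrite mem_filter => /andP[].
- by move=> x; have [xph _] := phP x; exact: lt_trans xph (bP _).
- by have [_ []] := phP x.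
have [xi1 [low1 lowp1 up1 upt1 _]] := phP xi; have [eta1 [low2 lowp2 up2 upt2 _]] := phP eta.
have up_lt y : y \in up (ph xi) ->
    y < b (ph eta) /\ profile (b (ph eta)) y = profile (b (ph xi)) y.
  move=> yup; have iy : (index y (up (ph xi)) < k)%N by rewrite -up1 index_mem.
  have ay : a xi (Ordinal iy) = y by rewrite /a /= nth_index.
  have yd : y < b (ph eta).
    rewrite -ay; apply: lt_trans (bP _); apply: lt_trans eta1.
    exact: lt_le_trans (adl _) deta.
  split=> //; rewrite {1}/profile (lt_eqF yd) yd /=.
  have := col (Ordinal iy); rewrite ay /= => ->.
  by rewrite -upt1 (nth_map bot) ?up1 //= nth_index.
exists (ph xi), (ph eta); split.
  have bup : b (ph xi) \in up (ph xi).
    by rewrite mem_filter mem_undup mem_head ltW.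
  have ib : (index (b (ph xi)) (up (ph xi)) < k)%N by rewrite -up1 index_mem.
  have := adl (Ordinal ib); rewrite /a /= nth_index // => bd.
  by apply: ltW; apply: lt_trans eta1; exact: lt_le_trans bd deta.
move=> x xF; have xG : x \in G (ph xi) by rewrite mem_undup inE xF orbT.
have [xlow|xup] := ltP x (ph xi); last first.
  by have [] := up_lt x; rewrite ?mem_filter ?xup.
have {}xlow : x \in low (ph xi) by rewrite mem_filter xlow.
move: xlow => {xF xG}; move: x; apply/eq_in_map; rewrite lowp1.
by rewrite low1 -low2 lowp2.
Qed.

Lemma profile_inj b b' : profile b =1 profile b' -> b = b'.
Proof.
move=> H; have := H b; have := H b'; rewrite /profile !eqxx /=.
by case: (ltgtP b b').
Qed.

End Coloring.

(** * The topology of pointwise convergence *)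

(** A copy of [T], which depends on [w] so that it can carry a topology. *)
Definition pointwise (T I : Type) (w : T -> I -> bool) : Type := T.

Section Pointwise.
Context {T : choiceType} {I : eqType} (w : T -> I -> bool).

HB.instance Definition _ := Choice.on (pointwise w).

Definition agree_on (F : seq I) (x : T) : set T := [set y | {in F, w y =1 w x}].

Definition pointwise_open : set (set (pointwise w)) :=
  [set A | forall x, A x -> exists F, agree_on F x `<=` A].

Lemma pointwise_openT : pointwise_open setT.
Proof. by move=> x _; exists [::]. Qed.

Lemma pointwise_openI : setI_closed pointwise_open.
Proof.
move=> A B Aop Bop x [/Aop[F FA] /Bop[G GB]]; exists (F ++ G) => y yFG; split.
  by apply: FA => i iF; apply: yFG; rewrite mem_cat iF.
by apply: GB => i iG; apply: yFG; rewrite mem_cat iG orbT.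
Qed.

Lemma pointwise_open_bigcup (J : Type) (f : J -> set (pointwise w)) :
  (forall j, pointwise_open (f j)) -> pointwise_open (\bigcup_j f j).
Proof.
by move=> fop x [j _ /fop[F Ff]]; exists F => y /Ff; exists j.
Qed.

HB.instance Definition _ := isOpenTopological.Build (pointwise w)
  pointwise_openT pointwise_openI pointwise_open_bigcup.

Lemma pointwise_nbhs (x : pointwise w) A : nbhs x A <-> exists F, agree_on F x `<=` A.
Proof.
split=> [[B [Bop Bx BA]]|[F FA]].
  by have [F FB] := Bop _ Bx; exists F; exact: subset_trans BA.
exists (agree_on F x); split=> //.
move=> y yF; exists F => z zF i iF; by rewrite zF // yF.
Qed.

Lemma pointwise_regular : regular_space (pointwise w).
Proof.
move=> x A /pointwise_nbhs[F FA]; exists (agree_on F x).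
  by apply/pointwise_nbhs; exists F.
move=> y ycl; apply: FA => i iF.
have [|z [zx zy]] := ycl (agree_on F y); first by apply/pointwise_nbhs; exists F.
by rewrite -zx // zy.
Qed.

Lemma pointwise_hausdorff : (forall x y, w x =1 w y -> x = y) ->
  hausdorff_space (pointwise w).
Proof.
move=> winj x y xy; apply: winj => i.
have [||z [zx zy]] := xy (agree_on [:: i] x) (agree_on [:: i] y).
- by apply/pointwise_nbhs; exists [:: i].
- by apply/pointwise_nbhs; exists [:: i].
by rewrite -zx ?mem_head // zy ?mem_head.
Qed.

End Pointwise.

(** * The L space *)

Section LSpace.
Context {d : Order.disp_t} {W : orderType d}.
Hypothesis W1 : omega1_like W.

(** Without a countable subcover, each [th] has a point [b th] outside the members
    of the cover chosen for the points up to [th]; it is then above [th].  The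
    hypothesis puts some [b th] in the neighbourhood chosen for some
    [b th' <= th], which is a contradiction. *)
Lemma pointwise_hereditarily_lindelof (w : W -> W -> bool) :
  (forall (b : W -> W) (F : W -> seq W), (forall x, x < b x) ->
    exists th' th, b th' <= th /\ {in F (b th'), w (b th) =1 w (b th')}) ->
  hereditarily_lindelof_space (pointwise w).
Proof.
move=> wP A C Cop Ccov; apply: contrapT => no.
have /choice[UF UFP] : forall x : W, exists UF : set (set_type A) * seq W,
    A x -> C UF.1 /\ forall y : set_type A, agree_on w UF.2 x (val y) -> UF.1 y.
  move=> x; have [Ax|nAx] := pselect (A x); last by exists (set0, [::]).
  pose x' : set_type A := SigSub (mem_set Ax).
  have [U CU Ux] : cover C id x' by rewrite Ccov.
  have [B Bop BU] := Cop _ CU.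
  have Bx : B x by have : (val @^-1` B) x' by rewrite BU.
  have /pointwise_nbhs[F FB] := open_nbhs_nbhs (conj Bop Bx).
  by exists (U, F) => _; split=> // y /FB; rewrite -BU.
have /choice[y yP] : forall th, exists y : set_type A,
    forall x, x <= th -> A x -> ~ (UF x).1 y.
  move=> th; apply: contrapT => noy; apply: no.
  exists [set U | exists x, [/\ x <= th, A x & U = (UF x).1]]; split.
  - by move=> U [x [_ /UFP[CU _] ->]].
  - apply: sub_countable (countable_le_segment W1 th).
    apply: card_le_trans (card_image_le (fun x => (UF x).1) _).
    by apply: subset_card_le => U [x [xth _ ->]]; exists x.
  - apply/seteqP; split=> // y _; apply: contrapT => ny; apply: noy; exists y => x xth Ax Uy.
    by apply: ny; exists (UF x).1 => //; exists x.
have Ay th : A (val (y th)) by exact: set_valP.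
have [|th' [th [le agr]]] := wP (fun th => val (y th)) (fun x => (UF x).2).
  move=> th; rewrite ltNge; apply/negP => le; apply: (yP th _ le (Ay th)).
  by have [_] := UFP _ (Ay th); apply.
by apply: (yP th _ le (Ay th')); have [_] := UFP _ (Ay th'); apply.
Qed.

Lemma pointwise_not_separable (w : W -> W -> bool) :
  (forall x, w x x) -> (forall x y, y < x -> ~~ w y x) ->
  ~ separable_space (pointwise w).
Proof.
move=> wxx wlt [D cD dD]; have [u uP] := countable_bounded W1 cD.
have [||x [/= wxu Dx]] := dD [set x | w x u].
- by exists u; exact: wxx.
- by move=> x wxu; exists [:: u] => y yu; rewrite /= yu ?mem_head.
by have := wlt _ _ (uP _ Dx); rewrite wxu.
Qed.

End LSpace.

Lemma uncountable_subsets : ~ countable [set: nat -> bool].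
Proof.
move=> cN; have [s [_ sP]] := countable_surjection cN (I : setT (fun=> true)).
have [n /(congr1 (fun f => f n))] := sP (fun n => ~~ s n n) I.
by case: (s n n).
Qed.

(** In a well-ordering of [T], the whole of [T] or else the first uncountable
    initial segment has countable proper initial segments. *)
Lemma omega1_like_exists (T : choiceType) : ~ countable [set: T] ->
  exists d (W : orderType d), omega1_like W /\ exists f : W -> T, injective f.
Proof.
move=> uncT; have [R Rwo] := wochoice.well_ordering_principle T.
have Rmin (A : set T) : A !=set0 -> exists2 z, A z & forall x, A x -> R z x.
  move=> [x Ax]; have [|z [[Az zP] _]] := Rwo [pred x | `[< A x >]].
    by exists x; exact/asboolP.
  exists z; first exact/asboolP.
  by move=> y Ay; apply: zP; exact/asboolP.
have Rtot : total R.
  move=> x y; have [|z [->|->] zP] := Rmin [set x; y]; first by exists x; left.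
  - by rewrite zP //; right.
  - by rewrite [R y x]zP ?orbT //; left.
have Ranti : antisymmetric R.
  move=> x y /andP[xy yx]; have [|z [[Az zP] zu]] := Rwo [pred z | (z == x) || (z == y)].
    by exists x; rewrite inE eqxx.
  have Rxx t : R t t by have := Rtot t t; rewrite orbb.
  rewrite -(zu x); first rewrite -(zu y) //; split; rewrite ?inE ?eqxx ?orbT //.
  + by move=> t /orP[/eqP->|/eqP->].
  + by move=> t /orP[/eqP->|/eqP->].
have Rtrans : transitive R.
  move=> y x z xy yz; have [|t [[->|->]|->] tP] := Rmin ([set x; y] `|` [set z]).
  - by exists x; left; left.
  - by apply: tP; right.
  - have yx : R y x by apply: tP; left; left.
    by rewrite (Ranti x y) // xy.
  - have zy : R z y by apply: tP; left; right.
    by rewrite -(Ranti y z) // yz.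
have [X uncX segX] : exists2 X : set T, ~ countable X &
    forall x, X x -> countable [set y | X y /\ (R y x /\ y <> x)].
  pose seg x := [set y | R y x /\ y <> x].
  have [no|/existsNP[x0 nx0]] := pselect (forall x, countable (seg x)).
    exists setT => // x _; apply: sub_countable (no x).
    by apply: subset_card_le => y [].
  have [|x nx xP] := Rmin [set x | ~ countable (seg x)]; first by exists x0.
  exists (seg x) => // y [yx ney]; apply: contrapT => nc; apply: ney.
  apply: Ranti; rewrite yx /=; apply: xP => /= cy; apply: nc.
  by apply: sub_countable cy; apply: subset_card_le => z [].
pose le (x y : set_type X) := R (val x) (val y).
have le_refl : reflexive le by move=> x; have := Rtot (val x) (val x); rewrite orbb.
have le_anti : antisymmetric le by move=> x y /Ranti /val_inj.
have le_trans : transitive le by move=> x y z; exact: Rtrans.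
have le_total : total le by move=> x y; exact: Rtot.
pose po := Order.Le_isPOrder.Build Order.default_display (set_type X) le_refl le_anti le_trans.
pose P : porderType _ := HB.pack (set_type X) po.
pose to := Order.POrder_isTotal.Build _ P le_total.
pose W : orderType Order.default_display := HB.pack (set_type X) po to.
exists Order.default_display, W; split; last by exists val; exact: val_inj.
have ltE (x y : W) : x < y -> R (val x) (val y) /\ val x <> val y.
  by rewrite lt_neqAle => /andP[/eqP xy ?]; split=> // /val_inj.
have val_countable (A : set W) : countable [set val x | x in A] -> countable A.
  by rewrite (eq_countable (inj_card_eq _)) // => x y _ _; exact: val_inj.
split.
- move=> x; apply: contrapT => nx.
  have [|_ [z nz <-] zP] :=
      Rmin [set val y | y in [set y : W | ~ Acc (fun x y : W => x < y) y]].
    by exists (val x), x.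
  apply: nz; split=> y yz; apply: contrapT => ny.
  have [Ryz] := ltE _ _ yz; apply; apply: Ranti; rewrite Ryz zP //.
  by exists y.
- move=> x; apply: val_countable; apply: sub_countable (segX (val x) (set_valP x)).
  by apply: subset_card_le => _ [y /ltE xy <-]; split=> //; exact: set_valP.
- move=> cW; apply: uncX; apply: sub_countable cW.
  apply: card_le_trans (card_image_le (val : W -> T) _).
  by apply: subset_card_le => t Xt; exists (SigSub (mem_set Xt) : W).
Qed.

Theorem theorem1p12 :
  exists T : topologicalType,
    [/\ regular_space T, hausdorff_space T, ~ separable_space T
      & hereditarily_lindelof_space T].
Proof.
have [d [W [W1 [f finj]]]] := omega1_like_exists uncountable_subsets.
have [c cP] := ladder_exists W1.
have [w0 _] := countable_bounded W1 (@countable0 W).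
have [bot [_ botP]] := least_element W1 (ex_intro (fun=> True) w0 I).
have {}botP x : bot <= x by exact: botP.
have [th thP] := @simultaneous_half_turns (Rdefinitions.R : realType).
pose g (a : W) := half_turn (th (f a)).
have gP k (A : 'I_k -> W) : injective A -> exists N, hits_within g N A.
  move=> Ainj; have [|N NP] := thP k (f \o A); first exact: inj_comp.
  by exists N.
exists (pointwise (profile W1 c bot g)); split.
- exact: pointwise_regular.
- by apply: pointwise_hausdorff => x y; exact: profile_inj.
- apply: (pointwise_not_separable W1) => [x|x y yx]; first by rewrite /profile eqxx.
  by rewrite /profile (gt_eqF yx) ltNge (ltW yx).
- by apply: (pointwise_hereditarily_lindelof W1) => b F; exact: profile_realized.
Qed.
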